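(* Let $n_u\ge 1$, let $\mathcal{Q}\subset\mathbb{R}^{n_u}$ be convex, and let $f$ be a real-valued function that is twice continuously differentiable on $\mathcal{Q}$ and whose gradient is Lipschitz continuous on $\mathcal{Q}$ with constant $L\ge 0$. Let $\mathcal{U}=\{u_0,u_1,\dots,u_{n_u}\}\subset\mathcal{Q}$ be such that $U=[\,u_1-u_0,\ \dots,\ u_{n_u}-u_0\,]\in\mathbb{R}^{n_u\times n_u}$ is nonsingular. Then the projections of the truncation gradient error $\epsilon_t(u_0)=g_t-\nabla f(u_0)$ in the directions given by the columns of $U$ are bounded by the radial bound $T_r$, that is, $$\left|\epsilon_t(u_0)^{\mathsf T}\,\frac{u_j-u_0}{\|u_j-u_0\|}\right|\le T_r,\qquad j=1,\dots,n_u.$$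
   Context: $\|\cdot\|$ denotes the Euclidean norm of a vector (row or column). Vectors $u_j\in\mathbb{R}^{n_u}$ are column vectors and gradients are column vectors. The gradient $\nabla f$ is Lipschitz continuous on $\mathcal{Q}$ with constant $L$ if $\|\nabla f(a)-\nabla f(b)\|\le L\|a-b\|$ for all $a,b\in\mathcal{Q}$. The noise-free simplex gradient is $$g_t=(U^{-1})^{\mathsf T}\bigl[f(u_1)-f(u_0),\ \dots,\ f(u_{n_u})-f(u_0)\bigr]^{\mathsf T}.$$ The radial bound is $T_r=L\,r(\mathcal{U})$ with $$r(\mathcal{U})=\frac12\Bigl\|\bigl[\,(u_1-u_0)^{\mathsf T}(u_1-u_0),\ \dots,\ (u_{n_u}-u_0)^{\mathsf T}(u_{n_u}-u_0)\,\bigr]\,U^{-1}\Bigr\|.$$ *)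

(* Defs.v *)
From HB Require Import structures.
From mathcomp Require Import all_boot all_order all_algebra.
From mathcomp Require Import all_classical all_reals all_analysis.

Set Implicit Arguments.
Unset Strict Implicit.
Unset Printing Implicit Defensive.

Import Order.TTheory GRing.Theory Num.Theory.
Import numFieldNormedType.Exports.

Local Open Scope classical_set_scope.
Local Open Scope ring_scope.

(* The norm `|A| of the library is the sup norm.  The Euclidean norm is defined
   on matrices of any shape so that it applies to rows and columns alike. *)
Definition enorm (R : realType) (m n : nat) (A : 'M[R]_(m, n)) : R :=
  Num.sqrt (\sum_(i < m) \sum_(j < n) A i j ^+ 2).

Section calculus_on_a_set.
Context {R : realType} {n : nat}.
Implicit Types (Q : set 'cV[R]_n) (f : 'cV[R]_n -> R).

(* Differentials are taken along the filter of neighbourhoods of x within Q: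
   only the values on Q matter, and on the boundary of Q derivatives are
   relative to Q.  At interior points this filter is nbhs x and these are the
   ordinary derivatives.  When Q is convex with nonempty interior the
   differential at a point of Q is unique, so the gradient and the Hessian do
   not depend on the choice operator underlying 'd. *)
Definition gradient_on Q f (x : 'cV[R]_n) : 'cV[R]_n :=
  \col_i 'd f (within Q (nbhs x)) (delta_mx i 0).

Definition hessian_on Q f (x : 'cV[R]_n) : 'M[R]_n :=
  \matrix_(i, j)
    ('d (gradient_on Q f) (within Q (nbhs x)) (delta_mx j 0 : 'cV[R]_n)) i 0.

Definition twice_continuously_differentiable_on Q f : Prop :=
  [/\ forall x, Q x -> differentiable f (within Q (nbhs x)),
      forall x, Q x -> differentiable (gradient_on Q f) (within Q (nbhs x))
    & {within Q, continuous (hessian_on Q f)}].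

Definition elipschitz_on (L : R) Q (g : 'cV[R]_n -> 'cV[R]_n) : Prop :=
  forall a b, Q a -> Q b -> enorm (g a - g b) <= L * enorm (a - b).

End calculus_on_a_set.

Section simplex_gradient.
Context {R : realType} {n : nat}.
Implicit Types (u : 'I_n.+1 -> 'cV[R]_n) (f : 'cV[R]_n -> R).

(* The n.+1 points are u_0, ..., u_n; the j-th column of the matrix, j < n,
   is u_(j+1) - u_0. *)
Definition edge u (j : 'I_n) : 'cV[R]_n := u (lift ord0 j) - u ord0.

Definition edge_matrix u : 'M[R]_n := \matrix_(i, j) edge u j i 0.

Definition simplex_gradient f u : 'cV[R]_n :=
  (invmx (edge_matrix u))^T *m \col_j (f (u (lift ord0 j)) - f (u ord0)).

Definition radius u : R :=
  2^-1 * enorm ((\row_j ((edge u j)^T *m edge u j) 0 0)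
                *m invmx (edge_matrix u)).

Definition radial_bound (L : R) u : R := L * radius u.

Definition truncation_error Q f u : 'cV[R]_n :=
  simplex_gradient f u - gradient_on Q f (u ord0).

End simplex_gradient.

(* Main.v *)
Require Import Defs.
From HB Require Import structures.
From mathcomp Require Import all_boot all_order all_algebra.
From mathcomp Require Import all_classical all_reals all_analysis ring lra.

Set Implicit Arguments.
Unset Strict Implicit.
Unset Printing Implicit Defensive.

Import Order.TTheory GRing.Theory Num.Theory.
Import numFieldNormedType.Exports.
Local Open Scope classical_set_scope.
Local Open Scope ring_scope.

(** The projected error is a first order Taylor remainder.  By construction the
    simplex gradient interpolates [f]: its inner product with the edge
    [e_j = u_j - u_0] is [f u_j - f u_0] ([simplex_gradient_edge]).  So the
    inner product of the truncation error with [e_j] is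
    [f u_j - f u_0 - <grad f u_0, e_j>], which is at most
    [L / 2 * |e_j| ^ 2] in absolute value because the gradient is
    [L]-Lipschitz along the segment from [u_0] to [u_j]
    ([lipschitz_gradient_taylor]).  Normalizing the direction divides by
    [|e_j|] and leaves [L / 2 * |e_j|].

    It remains to see that no edge is longer than twice the radius
    ([enorm_edge_le]).  The radius is half the norm of the row [w] that solves
    [w U = (|e_1| ^ 2, ..., |e_n| ^ 2)], so [w e_j = |e_j| ^ 2], and
    Cauchy-Schwarz gives [|e_j| ^ 2 <= |w| |e_j|].

    The Taylor bound comes from the mean value theorem for
    [phi t = f (a + t *: v)] on [[0, 1]].  The differentials of [f] are taken
    relative to [Q]; since the segment stays in [Q], they still give the
    two-sided derivative of [phi] on the open interval and the continuity of
    [phi] at the end points, wherever the segment lies in [Q], even on its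
    boundary. *)

(** * Euclidean norm *)

Lemma enorm_ge0 (R : realType) m n (A : 'M[R]_(m, n)) : 0 <= enorm A.
Proof. exact: sqrtr_ge0. Qed.

Lemma sqr_enorm_row (R : realType) n (w : 'rV[R]_n) :
  enorm w ^+ 2 = \sum_j w 0 j ^+ 2.
Proof.
rewrite /enorm big_ord1 sqr_sqrtr//.
by apply: sumr_ge0 => j _; exact: sqr_ge0.
Qed.

Lemma sqr_enorm_col (R : realType) n (v : 'cV[R]_n) :
  enorm v ^+ 2 = \sum_i v i 0 ^+ 2.
Proof.
rewrite /enorm sqr_sqrtr; first by apply: eq_bigr => i _; rewrite big_ord1.
by apply: sumr_ge0 => i _; apply: sumr_ge0 => j _; exact: sqr_ge0.
Qed.

Lemma enorm_trmx (R : realType) m n (A : 'M[R]_(m, n)) : enorm A^T = enorm A.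
Proof.
rewrite /enorm exchange_big; congr Num.sqrt.
by apply: eq_bigr => i _; apply: eq_bigr => j _; rewrite mxE.
Qed.

Lemma enormZ (R : realType) m n (a : R) (A : 'M[R]_(m, n)) :
  enorm (a *: A) = `|a| * enorm A.
Proof.
rewrite /enorm -sqrtr_sqr -sqrtrM ?sqr_ge0// mulr_sumr; congr Num.sqrt.
apply: eq_bigr => i _; rewrite mulr_sumr; apply: eq_bigr => j _.
by rewrite mxE exprMn.
Qed.

Lemma trmx_mul_self (R : realType) n (v : 'cV[R]_n) :
  (v^T *m v) 0 0 = enorm v ^+ 2.
Proof.
by rewrite sqr_enorm_col mxE; apply: eq_bigr => i _; rewrite mxE expr2.
Qed.

Lemma mulmx_trBl (R : realType) n (g h v : 'cV[R]_n) :
  ((g - h)^T *m v) 0 0 = (g^T *m v) 0 0 - (h^T *m v) 0 0.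
Proof.
by rewrite [(g - h)^T]linearB mulmxBl [in LHS]mxE [in X in _ + X = _]mxE.
Qed.

(** With [A], [B] the squared norms and [C] the inner product,
    [B * (A * B - C ^+ 2)] is the squared norm of [B *: w - C *: v^T], hence
    nonnegative. *)
Lemma cauchy_schwarz (R : realType) n (w : 'rV[R]_n) (v : 'cV[R]_n) :
  `|(w *m v) 0 0| <= enorm w * enorm v.
Proof.
rewrite -(ler_pXn2r (n := 2))// ?nnegrE ?mulr_ge0 ?enorm_ge0//.
rewrite real_normK ?num_real// exprMn sqr_enorm_row sqr_enorm_col mxE.
set A := \sum_j w 0 j ^+ 2; set B := \sum_i v i 0 ^+ 2.
set C := \sum_j w 0 j * v j 0.
have B0 : 0 <= B by apply: sumr_ge0 => i _; exact: sqr_ge0.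
have : 0 <= \sum_j (B * w 0 j - C * v j 0) ^+ 2.
  by apply: sumr_ge0 => j _; exact: sqr_ge0.
have -> : \sum_j (B * w 0 j - C * v j 0) ^+ 2 = B * (A * B - C ^+ 2).
  rewrite (eq_bigr (fun j => B ^+ 2 * w 0 j ^+ 2 - B * C * 2 * (w 0 j * v j 0)
                             + C ^+ 2 * v j 0 ^+ 2)); last by move=> j _; ring.
  by rewrite big_split sumrB/= -!mulr_sumr -/A -/B -/C; ring.
have [B_gt0|] := ltP 0 B; first by rewrite pmulr_rge0// subr_ge0.
move=> B_le0 _; have/eqP B_eq0 : B == 0 by rewrite eq_le B_le0 B0.
suff -> : C = 0 by rewrite expr0n B_eq0 mulr0.
apply: big1 => j _; move/eqP: B_eq0.
rewrite psumr_eq0; last by move=> i _; exact: sqr_ge0.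
move=> /allP/(_ j (mem_index_enum _)); rewrite /= sqrf_eq0 => /eqP ->.
by rewrite mulr0.
Qed.

Lemma enorm_gt0 (R : realType) n (v : 'cV[R]_n) : v != 0 -> 0 < enorm v.
Proof.
move=> v0; rewrite lt_neqAle enorm_ge0 andbT eq_sym; apply: contra v0 => /eqP e.
apply/eqP/colP => i; rewrite mxE; apply/eqP; rewrite -sqrf_eq0.
have := sqr_enorm_col v; rewrite e expr0n/= => /esym/eqP.
rewrite psumr_eq0; last by move=> k _; exact: sqr_ge0.
by move=> /allP/(_ i (mem_index_enum _)).
Qed.

(** * Edges of the simplex *)

Lemma col_edge_matrix (R : realType) n (u : 'I_n.+1 -> 'cV[R]_n) j :
  col j (edge_matrix u) = edge u j.
Proof. by apply/colP => i; rewrite !mxE. Qed.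

Lemma edge_neq0 (R : realType) n (u : 'I_n.+1 -> 'cV[R]_n) j :
  edge_matrix u \in unitmx -> edge u j != 0.
Proof.
move=> Uu; apply/eqP => e0.
have : col j (edge_matrix u) = 0 by rewrite col_edge_matrix.
move=> /(congr1 (mulmx (invmx (edge_matrix u)))).
rewrite mulmx0 colE mulKmx// => /colP/(_ j); rewrite !mxE !eqxx => /eqP.
by rewrite oner_eq0.
Qed.

(** The row [w] in the definition of the radius satisfies
    [w e_j = |e_j| ^ 2], so Cauchy-Schwarz bounds [|e_j|] by [|w|]. *)
Lemma enorm_edge_le (R : realType) n (u : 'I_n.+1 -> 'cV[R]_n) j :
  edge_matrix u \in unitmx -> enorm (edge u j) <= 2 * Defs.radius u.
Proof.
move=> Uu; rewrite /Defs.radius mulrA divff ?pnatr_eq0// mul1r.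
set d := \row_j _; set w := _ *m invmx _.
have wE : (w *m edge u j) 0 0 = enorm (edge u j) ^+ 2.
  rewrite -[in LHS]col_edge_matrix colE mulmxA mulmxKV// -colE.
  by rewrite mxE mxE trmx_mul_self.
have := cauchy_schwarz w (edge u j).
rewrite wE ger0_norm ?sqr_ge0// expr2 ler_pM2r//.
exact/enorm_gt0/edge_neq0.
Qed.

(** The simplex gradient is the slope of the affine interpolant of [f] at the
    vertices. *)
Lemma simplex_gradient_edge (R : realType) n (f : 'cV[R]_n -> R) u j :
  edge_matrix u \in unitmx ->
  ((simplex_gradient f u)^T *m edge u j) 0 0 = f (u (lift ord0 j)) - f (u ord0).
Proof.
move=> Uu; rewrite -col_edge_matrix.
by rewrite /simplex_gradient trmx_mul trmxK colE mulmxA mulmxKV// -colE !mxE.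
Qed.

(** * Derivative along a segment *)

Lemma gradient_onE (R : realType) n (Q : set 'cV[R]_n) (f : 'cV[R]_n -> R) x v :
  'd f (within Q (nbhs x)) v = ((gradient_on Q f x)^T *m v) 0 0.
Proof.
rewrite [in LHS](matrix_sum_delta v) linear_sum mxE; apply: eq_bigr => i _.
by rewrite big_ord1 linearZ !mxE mulrC.
Qed.

Lemma convex_segment (R : realType) n (Q : set 'cV[R]_n) a b t :
  convex_set (Q : set (convex_lmodType 'cV[R]_n)) ->
  Q a -> Q b -> 0 <= t <= 1 -> Q (a + t *: (b - a)).
Proof.
move=> cQ Qa Qb t01.
have /andP[t0 t1] := t01.
have := cQ b a (Itv01 t0 t1); rewrite !inE => /(_ Qb Qa).
rewrite [X in Q X -> _](_ : _ = t *: b + (1 - t) *: a)//.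
by rewrite scalerBl scale1r scalerBr addrCA.
Qed.

(** The differential relative to [Q] is expressed with the limit of the filter
    [within Q (nbhs x)]; as [x] belongs to [Q] this filter is proper and its
    limit is [x]. *)
Lemma diff_within_bound (R : realType) (V W : normedModType R) (Q : set V)
    (f : V -> W) (x : V) (e : R) :
  Q x -> differentiable f (within Q (nbhs x)) -> 0 < e ->
  \forall y \near nbhs x, Q y ->
    `|f y - f x - 'd f (within Q (nbhs x)) (y - x)| <= e * `|y - x|.
Proof.
move=> Qx df e0.
have PF : ProperFilter (within Q (nbhs x)).
  exact: within_nbhs_proper (subset_closure Qx).
have limE : lim (within Q (nbhs x)) = x.
  exact/norm_cvg_lim/cvg_within.
case: df => -[_ /eqaddoP/(_ _ e0)].
rewrite limE near_withinE; apply: filterS => y h Qy; have := h Qy.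
by rewrite !fctE/= opprD addrA.
Qed.

(** A function that is differentiable relative to [Q] is restricted here to a
    segment contained in [Q].  Only increments inside the segment can be
    controlled, which at the end points leaves one-sided information. *)
Section along_a_segment.
Context {R : realType} {V : normedModType R}.
Variables (Q : set V) (f : V -> R) (a v : V).
Hypothesis segQ : forall t : R, 0 <= t <= 1 -> Q (a + t *: v).
Hypothesis df : forall x, Q x -> differentiable f (within Q (nbhs x)).

Let phi (t : R) : R := f (a + t *: v).
Let dphi (t : R) : R := 'd f (within Q (nbhs (a + t *: v))) v.

(** Common source of the derivative and of the continuity of [phi]: the first
    order expansion of [f] pulled back along [s |-> a + s *: v]. *)
Lemma segment_first_order (t e : R) : 0 <= t <= 1 -> 0 < e ->
  \forall s \near nbhs t, 0 <= s <= 1 ->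
    `|phi s - phi t - (s - t) * dphi t| <= e * `|s - t|.
Proof.
move=> t01 e0; have Qt := segQ t01.
(* 1 is added because the direction v may vanish. *)
have e'0 : 0 < e / (`|v| + 1) by rewrite divr_gt0// ltr_wpDl.
have line_cont : a + s *: v @[s --> t] --> a + t *: v.
  by apply: cvgD; [exact: cvg_cst|apply: cvgZr_tmp; exact: cvg_id].
have : \forall s \near t, Q (a + s *: v) ->
    `|phi s - phi t - 'd f (within Q (nbhs (a + t *: v)))
       (a + s *: v - (a + t *: v))|
    <= e / (`|v| + 1) * `|a + s *: v - (a + t *: v)|.
  exact: line_cont (diff_within_bound Qt (df Qt) e'0).
apply: filterS => s h /segQ/h.
rewrite opprD addrACA subrr add0r -scalerBl linearZ normrZ => /le_trans; apply.
rewrite mulrA (mulrC _ `|s - t|) [leRHS]mulrC -mulrA ler_wpM2l//.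
by rewrite mulrAC ler_pdivrMr ?ltr_wpDl// (ler_wpM2l (ltW e0))// lerDl.
Qed.

Lemma segment_is_derive (t : R) : t \in `]0, 1[%R -> is_derive t 1 phi (dphi t).
Proof.
move=> t01; have t01' : 0 <= t <= 1 by rewrite !ltW// (itvP t01).
have slope : h^-1 *: ((phi \o shift t) (h *: 1) - phi t) @[h --> 0^'] --> dphi t.
  apply/cvgrPdist_le => e e0.
  have shift_cvg : h + t @[h --> (0 : R)^'] --> t.
    rewrite -[X in _ --> X]add0r; apply: cvgD; last exact: cvg_cst.
    exact: cvg_within.
  (* An interior t has a full neighbourhood in the segment, so the slopes
     from both sides are controlled. *)
  have near01 : \forall s \near t, 0 <= s <= 1.
    have := near_in_itvoo t01; apply: filterS => s s01.
    by rewrite !ltW// (itvP s01).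
  near=> h.
  have h0 : h != 0 by near: h; exact: nbhs_dnbhs_neq.
  have /= ht01 : 0 <= h + t <= 1 by near: h; exact: shift_cvg near01.
  have /(_ ht01) : 0 <= h + t <= 1 ->
      `|phi (h + t) - phi t - (h + t - t) * dphi t| <= e * `|h + t - t|.
    by near: h; exact: shift_cvg (segment_first_order t01' e0).
  rewrite addrK distrC /= [h *: 1]mulr1 [_ *: _]mulrC => bound.
  rewrite -(ler_pM2r (_ : 0 < `|h|)) ?normr_gt0// -normrM.
  by rewrite mulrBl mulfVK// [dphi t * h]mulrC.
constructor; first by apply/cvg_ex; exists (dphi t).
exact: cvg_lim.
Unshelve. all: by end_near. Qed.

Lemma segment_continuous : {within `[0, 1], continuous phi}.
Proof.
apply/subspace_continuousP => t; rewrite /= in_itv/= => t01.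
apply/cvgrPdist_le => e e0; rewrite near_withinE.
have k0 : 0 < 1 + `|dphi t| by rewrite ltr_wpDr.
near=> s; rewrite /= in_itv/= => s01.
have /(_ s01) bound : 0 <= s <= 1 ->
    `|phi s - phi t - (s - t) * dphi t| <= 1 * `|s - t|.
  by near: s; exact: segment_first_order t01 ltr01.
rewrite distrC -(subrK ((s - t) * dphi t) (phi s - phi t)).
apply: (le_trans (ler_normD _ _)); apply: (le_trans (lerD bound (lexx _))).
rewrite normrM mulrC -mulrDr -ler_pdivlMr// distrC.
near: s; apply: cvgr_dist_le; last by rewrite divr_gt0.
exact: cvg_id.
Unshelve. all: by end_near. Qed.

End along_a_segment.

(** * First order Taylor bound *)

(** Mean value theorem for [phi t - (d * t + c / 2 * t ^+ 2)], whose derivative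
    is nonpositive. *)
Lemma taylor1_upper_bound (R : realType) (phi dphi : R -> R) (d c : R) :
  {within `[0, 1], continuous phi} ->
  (forall t : R, t \in `]0, 1[%R -> is_derive t 1 phi (dphi t)) ->
  (forall t : R, t \in `]0, 1[%R -> dphi t - d <= c * t) ->
  phi 1 - phi 0 - d <= c / 2.
Proof.
move=> cphi dphiE le_dphi.
pose q t : R := d * t + c / 2 * t ^+ 2.
have dq (t : R) : is_derive t 1 q (d + c * t).
  by apply: is_derive_eq; rewrite /GRing.scale/=; lra.
have [] := @MVT R (phi - q) (fun t => dphi t - (d + c * t)) 0 1 ltr01.
- by move=> t t01; have := dphiE t t01 => ?; apply: is_deriveB.
- apply: within_continuousB => //; apply: derivable_within_continuous => t _.
  by have [] := dq t.
move=> t t01; rewrite subr0 mulr1 !fctE /q.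
have := le_dphi t t01; lra.
Qed.

(** The derivative of [t |-> f (a + t *: v)] drifts from its value at 0 by at
    most [L * |v| ^ 2 * t], by Cauchy-Schwarz and the Lipschitz condition; the upper
    bound for [phi] and for [- phi] gives both signs. *)
Lemma lipschitz_gradient_taylor (R : realType) n (Q : set 'cV[R]_n)
    (f : 'cV[R]_n -> R) L a b :
  convex_set (Q : set (convex_lmodType 'cV[R]_n)) ->
  (forall x, Q x -> differentiable f (within Q (nbhs x))) ->
  elipschitz_on L Q (gradient_on Q f) -> Q a -> Q b ->
  `|f b - f a - ((gradient_on Q f a)^T *m (b - a)) 0 0|
    <= L / 2 * enorm (b - a) ^+ 2.
Proof.
move=> cQ df lipQ Qa Qb; set v := b - a; set d := _ 0 0.
have segQ (t : R) : 0 <= t <= 1 -> Q (a + t *: v).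
  exact: (convex_segment cQ Qa Qb).
pose phi (t : R) : R := f (a + t *: v).
pose dphi (t : R) : R := 'd f (within Q (nbhs (a + t *: v))) v.
have phi0 : phi 0 = f a by rewrite /phi scale0r addr0.
have phi1 : phi 1 = f b by rewrite /phi scale1r addrC subrK.
have cphi : {within `[0, 1], continuous phi}.
  exact: (segment_continuous segQ df).
have dphiP (t : R) : t \in `]0, 1[%R -> is_derive t 1 phi (dphi t).
  exact: (segment_is_derive segQ df).
have lip (t : R) : t \in `]0, 1[%R -> `|dphi t - d| <= L * enorm v ^+ 2 * t.
  move=> t01; have t0 : 0 <= t by rewrite (itvP t01).
  have t1 : t <= 1 by rewrite (itvP t01).
  have Qt : Q (a + t *: v) by apply: segQ; rewrite t0.
  rewrite /dphi gradient_onE /d -mulmx_trBl.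
  apply: (le_trans (cauchy_schwarz _ _)); rewrite enorm_trmx.
  apply: (@le_trans _ _ (L * enorm (t *: v) * enorm v)).
    rewrite ler_wpM2r ?enorm_ge0//.
    have step : a + t *: v - a = t *: v by rewrite addrC addKr.
    rewrite -[X in L * enorm X]step; exact: lipQ.
  rewrite enormZ ger0_norm// [leLHS](_ : _ = L * enorm v ^+ 2 * t)//; ring.
rewrite -phi0 -phi1 mulrAC ler_norml; apply/andP; split.
- have ndphiP (t : R) : t \in `]0, 1[%R -> is_derive t 1 (- phi) (- dphi t).
    by move=> /dphiP ?; apply: is_deriveN.
  have := @taylor1_upper_bound R (- phi) (fun t => - dphi t) (- d)
    (L * enorm v ^+ 2) _ ndphiP.
  rewrite !fctE => ub; suff : - phi 1 - - phi 0 - - d <= L * enorm v ^+ 2 / 2.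
    lra.
  apply: ub => [x|t t01]; first by apply: cvgN; exact: cphi.
  by rewrite -opprD; have := lip t t01; rewrite ler_norml => /andP[]; lra.
- apply: (taylor1_upper_bound cphi dphiP) => t t01.
  exact: le_trans (ler_norm _) (lip t t01).
Qed.

(** * Error of the simplex gradient *)

Theorem corollary2 (R : realType) (n : nat) (Q : set 'cV[R]_n)
    (f : 'cV[R]_n -> R) (L : R) (u : 'I_n.+1 -> 'cV[R]_n) :
  (1 <= n)%N ->
  convex_set (Q : set (convex_lmodType 'cV[R]_n)) ->
  twice_continuously_differentiable_on Q f ->
  0 <= L ->
  elipschitz_on L Q (gradient_on Q f) ->
  (forall i : 'I_n.+1, Q (u i)) ->
  edge_matrix u \in unitmx ->
  forall j : 'I_n,
    `|((truncation_error Q f u)^T *m ((enorm (edge u j))^-1 *: edge u j)) 0 0|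
      <= radial_bound L u.
Proof.
move=> _ cQ [df _ _] L0 lipQ Qu Uu j.
have e_gt0 : 0 < enorm (edge u j) by exact/enorm_gt0/edge_neq0.
rewrite -scalemxAr mxE normrM normfV (ger0_norm (enorm_ge0 _)) mulrC.
rewrite ler_pdivrMr// /truncation_error mulmx_trBl.
rewrite simplex_gradient_edge//.
apply: (le_trans (lipschitz_gradient_taylor cQ df lipQ (Qu _) (Qu _))).
rewrite -/(edge u j) /radial_bound expr2 mulrA ler_wpM2r ?enorm_ge0//.
rewrite -mulrA ler_wpM2l//; have := enorm_edge_le j Uu; lra.
Qed.
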